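(* Let $f:\mathbb{R}^n\to\mathbb{R}$ be continuously differentiable, let $x^0\in\mathbb{R}^n$, and assume that the level set $\mathcal{L}_0=\{x\in\mathbb{R}^n\mid f(x)\le f(x^0)\}$ is compact. Let $\gamma(\cdot;x,d,\xi)$ be an admissible family of search curves, let $\{x^k\}_{k\ge 0}\subset\mathbb{R}^n$ (starting at $x^0$), $\{d_k\}\subset\mathbb{R}^n$, $\{\xi_k\}\subset\mathbb{R}^p$ be infinite sequences, put $\gamma_k(t)=\gamma(t;x^k,d_k,\xi_k)$, and suppose that for all $k\ge 0$ $$x^{k+1}=\gamma_k(t_k),$$ where: (i) for every $k$, the stepsize $t_k$ is the output of the Armijo-type curve search with parameters $\Delta_0\in(0,1]$, $\sigma\in(0,1)$, $\delta\in(0,1)$ (independent of $k$); (ii) the sequence of curves $\{\gamma_k\}$ is gradient-related to $\{x^k\}$; (iii) the sequence $\{\xi_k\}$ is bounded, i.e., there is $C>0$ with $\|\xi_k\|\le C$ for all $k$. Then the sequence $\{x^k\}$ admits accumulation points, and each accumulation point $\bar x$ of $\{x^k\}$ is stationary, i.e., $\nabla f(\bar x)=0$.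
   Context: Admissible family of search curves: a map $\gamma:[0,1]\times\mathbb{R}^n\times\mathbb{R}^n\times\mathbb{R}^p\to\mathbb{R}^n$, $(t,x,d,\xi)\mapsto\gamma(t;x,d,\xi)$, such that: (a) $\gamma$ is continuous as a function of $(t,x,d,\xi)$; (b) $\gamma(0;x,d,\xi)=x$ for all $x,d,\xi$; (c) the velocity $\gamma'(t;x,d,\xi)=\left(\frac{\partial\gamma_1(t;x,d,\xi)}{\partial t},\ldots,\frac{\partial\gamma_n(t;x,d,\xi)}{\partial t}\right)^\top$ exists for all $t,x,d,\xi$ and is continuous as a function of $(t,x,d,\xi)$ (one-sided derivatives at $t=0,1$); (d) $\gamma'(0;x,d,\xi)=d$ for all $x,d,\xi$. Gradient-related curves: $\{\gamma_k\}$ is gradient-related to $\{x^k\}$ if there exist constants $c_1,c_2>0$ such that for all $k\ge0$ $$\nabla f(x^k)^\top\gamma_k'(0)\le -c_1\|\nabla f(x^k)\|^2,\qquad \|\gamma_k'(0)\|\le c_2\|\nabla f(x^k)\|.$$ (Here $\gamma_k'(0)=d_k$.) Armijo-type curve search at iteration $k$ with parameters $\Delta_0\in(0,1]$, $\sigma,\delta\in(0,1)$: start with $t=\Delta_0$; while $f(\gamma_k(t))>f(x^k)+\sigma t\nabla f(x^k)^\top d_k$, replace $t$ by $\delta t$; upon termination output $t_k=t$. Equivalently, $t_k=\Delta_0\delta^{j}$ with $j\ge 0$ the smallest integer such that $f(\gamma_k(\Delta_0\delta^j))\le f(x^k)+\sigma\Delta_0\delta^j\nabla f(x^k)^\top d_k$.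 *)

(* Defs.v *)
From HB Require Import structures.
From mathcomp Require Import all_boot all_order all_algebra.
From mathcomp Require Import all_classical all_reals all_analysis.

Set Implicit Arguments.
Unset Strict Implicit.
Unset Printing Implicit Defensive.

Import Order.TTheory GRing.Theory Num.Theory.
Import numFieldNormedType.Exports.

Local Open Scope classical_set_scope.
Local Open Scope ring_scope.

(* Vectors of R^n are row vectors.  The library's norm `|u| on 'rV[R]_n is the
   sup norm, hence the explicit Euclidean norm below; the topology is the
   usual one in either case. *)
Definition dot (R : realType) (n : nat) (u v : 'rV[R]_n) : R :=
  \sum_(i < n) u 0 i * v 0 i.

Definition norm2 (R : realType) (n : nat) (u : 'rV[R]_n) : R :=
  Num.sqrt (dot u u).

Definition gradient (R : realType) (n : nat) (f : 'rV[R]_n -> R)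
    (x : 'rV[R]_n) : 'rV[R]_n :=
  \row_(i < n) 'D_(delta_mx 0 i) f x.

Definition continuously_differentiable (R : realType) (n : nat)
    (f : 'rV[R]_n -> R) : Prop :=
  (forall x, differentiable f x) /\ continuous (gradient f).

(* Derivatives relative to a set D: the difference quotient is taken along
   s in D, s != t, so it is one-sided at the endpoints of an interval.
   'derive_within' is only meaningful under 'derivable_within'. *)
Definition derivable_within (R : realType) (D : set R) (g : R -> R) (t : R)
    : Prop :=
  cvg ((g s - g t) / (s - t) @[s --> within D t^']).

Definition derive_within (R : realType) (D : set R) (g : R -> R) (t : R) : R :=
  lim ((g s - g t) / (s - t) @[s --> within D t^']).

Definition velocity (R : realType) (n : nat) (g : R -> 'rV[R]_n) (t : R)
    : 'rV[R]_n :=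
  \row_(i < n) derive_within `[0, 1] (fun s => g s 0 i) t.

(* A map with domain [0, 1] * R^n * R^n * R^p is represented by a total
   function of t : R; its values for t outside [0, 1] are irrelevant. *)
Definition curve_domain (R : realType) (n p : nat)
    : set (R * 'rV[R]_n * 'rV[R]_n * 'rV[R]_p) :=
  [set z : R * 'rV[R]_n * 'rV[R]_n * 'rV[R]_p | 0 <= z.1.1.1 <= 1].

Record admissible_family (R : realType) (n p : nat)
    (gamma : R -> 'rV[R]_n -> 'rV[R]_n -> 'rV[R]_p -> 'rV[R]_n) : Prop :=
  AdmissibleFamily {
    admissible_continuous :
      {within @curve_domain R n p,
        continuous (fun z => gamma z.1.1.1 z.1.1.2 z.1.2 z.2)};
    admissible_start : forall x d xi, gamma 0 x d xi = x;
    admissible_derivable : forall (t : R) x d xi, 0 <= t <= 1 ->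
      forall i, derivable_within `[0, 1] (fun s => gamma s x d xi 0 i) t;
    admissible_velocity_continuous :
      {within @curve_domain R n p,
        continuous (fun z =>
          velocity (fun s => gamma s z.1.1.2 z.1.2 z.2) z.1.1.1)};
    admissible_velocity_start : forall x d xi,
      velocity (fun s => gamma s x d xi) 0 = d
  }.

Definition gradient_related (R : realType) (n : nat) (f : 'rV[R]_n -> R)
    (x : nat -> 'rV[R]_n) (g : nat -> R -> 'rV[R]_n) : Prop :=
  exists c1 c2 : R, [/\ 0 < c1, 0 < c2 & forall k : nat,
    dot (gradient f (x k)) (velocity (g k) 0)
      <= - c1 * norm2 (gradient f (x k)) ^+ 2 /\
    norm2 (velocity (g k) 0) <= c2 * norm2 (gradient f (x k))].

Definition armijo_condition (R : realType) (n : nat) (f : 'rV[R]_n -> R)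
    (g : R -> 'rV[R]_n) (x d : 'rV[R]_n) (sigma t : R) : Prop :=
  f (g t) <= f x + sigma * t * dot (gradient f x) d.

(* The backtracking loop terminates and returns t. *)
Definition armijo_search_output (R : realType) (n : nat) (f : 'rV[R]_n -> R)
    (g : R -> 'rV[R]_n) (x d : 'rV[R]_n) (Delta0 sigma delta t : R) : Prop :=
  exists j : nat, [/\ t = Delta0 * delta ^+ j,
    armijo_condition f g x d sigma (Delta0 * delta ^+ j) &
    forall i : nat, (i < j)%N ->
      ~ armijo_condition f g x d sigma (Delta0 * delta ^+ i)].

Definition accumulation_point (R : realType) (n : nat) (x : nat -> 'rV[R]_n)
    (y : 'rV[R]_n) : Prop :=
  cluster (x k @[k --> \oo]) y.

(* Main.v *)
Require Import Defs.
From HB Require Import structures.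
From mathcomp Require Import all_boot all_order all_algebra.
From mathcomp Require Import all_classical all_reals all_analysis.
From mathcomp Require Import lra.

Import Order.TTheory GRing.Theory Num.Theory.
Import numFieldNormedType.Exports.

Local Open Scope classical_set_scope.
Local Open Scope ring_scope.

(** Suppose an accumulation point [y] has nonzero gradient and pick an
    ultrafilter [G] on the indices along which [x k] tends to [y]; the bounds on
    [d k] and [xi k] make these converge along [G] too.  Since [f (x k)]
    decreases to a limit, the Armijo decrease [t k * |grad f (x k)|^2] vanishes,
    hence [t k] tends to 0 along [G] and the previous trial step [t k / delta]
    was rejected.  The mean value theorem on [0, t k / delta] gives [th k],
    tending to 0, at which the slope of [f] along the k-th curve exceeds
    [sigma * (grad f (x k) . d k)].  In the limit
    [sigma * (grad f y . dbar) <= grad f y . dbar], contradicting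
    [grad f y . dbar <= - c1 * |grad f y|^2 < 0]. *)

(** * Convergence along filters and ultrafilters *)

Lemma ultra_compact_cvg {I : Type} {T : topologicalType} (G : set_system I)
    (K : set T) (u : I -> T) :
  UltraFilter G -> compact K -> (\forall i \near G, K (u i)) ->
  exists2 y, K y & u @ G --> y.
Proof.
move=> GU Kco GK; have [y [Ky uy]] := Kco (u @ G) _ GK.
(* An ultrafilter missing the preimage of [V] contains that of the complement, and clustering at [y]
   would make the complement meet [V]. *)
exists y => // V Vy; have [//|GV] := in_ultra_setVsetC (u @^-1` V) GU.
by have [z [nVz Vz]] := uy (~` V) V GV Vy.
Qed.

(** This stands in for passing to a subsequence. The sets [A] intersected with the preimage of [V],
    for [A] in [F] and [V] a neighbourhood of [y], form a filter base, proper because [y] is a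
    cluster point; [G] is an ultrafilter above it. *)
Lemma cluster_ultra_cvg {I : Type} {T : topologicalType} (F : set_system I)
    (u : I -> T) (y : T) :
  Filter F -> cluster (u @ F) y ->
  exists G, [/\ UltraFilter G, F `<=` G & u @ G --> y].
Proof.
move=> FF uy.
pose D := [set AV : set I * set T | F AV.1 /\ nbhs y AV.2].
pose B (AV : set I * set T) := AV.1 `&` u @^-1` AV.2.
have H_filter : Filter (filter_from D B).
  apply: filter_from_filter.
    by exists (setT, setT); split; exact: filterT.
  move=> [A V] [A' V'] [/= FA yV] [/= FA' yV'].
  exists (A `&` A', V `&` V'); first by split; exact: filterI.
  by move=> i [[Ai A'i] [Vi V'i]].
have H_proper : ProperFilter (filter_from D B).
  apply: filter_from_proper => -[A V] [/= FA yV].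
  have uA : (u @ F) (u @` A) by exact: filterS (@preimage_image _ _ u A) FA.
  have [_ [[i Ai <-] Vi]] := uy (u @` A) V uA yV.
  by exists i.
have [G [GU HG]] := ultraFilterLemma H_proper.
exists G; split=> //.
  move=> A FA; apply: HG; exists (A, setT) => [|i []//].
  by split=> //; exact: filterT.
move=> V yV; apply: HG; exists (setT, V) => [|i []//].
by split=> //; exact: filterT.
Qed.

Lemma cvg_within_comp {I : Type} {T U : topologicalType} {F : set_system I}
    {A : set T} {g : T -> U} {u : I -> T} {y : T} :
  Filter F -> {within A, continuous g} -> A y -> (\forall i \near F, A (u i)) ->
  u @ F --> y -> (g \o u) @ F --> g y.
Proof.
move=> FF /subspace_continuousP gA Ay FA uy; apply: cvg_trans (gA y Ay).
move=> V /= /uy; rewrite !nbhs_simpl/= => FV.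
by apply: filterS2 FV FA => i /= VAi Ai; exact: VAi.
Qed.

(** * Euclidean inner product and norm *)

Section euclidean.
Context {R : realType} {n : nat}.
Implicit Types u v : 'rV[R]_n.

Lemma dot_ge0 u : 0 <= dot u u.
Proof. by apply: sumr_ge0 => i _; rewrite -expr2 sqr_ge0. Qed.

Lemma norm2_ge0 u : 0 <= norm2 u.
Proof. exact: sqrtr_ge0. Qed.

Lemma norm_coord_le_norm2 u i : `|u 0 i| <= norm2 u.
Proof.
rewrite -sqrtr_sqr ler_wsqrtr// /dot (bigD1 i)//= expr2 lerDl.
by apply: sumr_ge0 => j _; rewrite -expr2 sqr_ge0.
Qed.

Lemma norm2_eq0 u : norm2 u = 0 -> u = 0.
Proof.
move=> u0; apply/rowP => i; rewrite mxE; apply/eqP.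
by rewrite -normr_le0 -u0 norm_coord_le_norm2.
Qed.

Lemma cvg_dot {I : Type} {F : set_system I} {FF : Filter F}
    {g h : I -> 'rV[R]_n} {u v} :
  g @ F --> u -> h @ F --> v -> dot (g i) (h i) @[i --> F] --> dot u v.
Proof.
move=> gu hv; pose gh j i := g i 0 j * h i 0 j.
apply: (@cvg_big _ _ _ _ _ _ _ _ _ gh) => [|j _].
  exact: add_continuous.
apply: cvgM.
  exact: (cvg_comp _ _ gu (@coord_continuous _ _ _ 0 j u)).
exact: (cvg_comp _ _ hv (@coord_continuous _ _ _ 0 j v)).
Qed.

Lemma cvg_norm2 {I : Type} {F : set_system I} {FF : Filter F}
    (g : I -> 'rV[R]_n) u :
  g @ F --> u -> norm2 (g i) @[i --> F] --> norm2 u.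
Proof.
move=> gu; apply: (continuous_cvg _ _ (cvg_dot gu gu)).
exact: sqrt_continuous.
Qed.

(** A Euclidean bound [M] confines the vectors to a cube, compact as a product of segments. *)
Lemma ultra_norm2_bounded_cvg {I : Type} (G : set_system I)
    (g : I -> 'rV[R]_n) (M : R) :
  UltraFilter G -> (\forall i \near G, norm2 (g i) <= M) ->
  exists u, g @ G --> u.
Proof.
move=> GU gM.
have [] := @ultra_compact_cvg _ _ G
  [set w : 'rV[R]_n | forall j, `[- M, M]%classic (w ord0 j)] g GU.
- apply: (@rV_compact _ _ (fun=> `[- M, M]%classic)) => j.
  exact: segment_compact.
- apply: filterS gM => i giM j /=; rewrite in_itv/= -ler_norml.
  exact: le_trans (norm_coord_le_norm2 _ _) giM.
- by move=> u _ gu; exists u.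
Qed.

End euclidean.

(** * Relative derivatives and the chain rule along a curve *)

Lemma within_filterE {T : Type} (F : set_system T) (D : set T) :
  Filter F -> F D -> within D F = F.
Proof.
move=> FF FD; rewrite predeqE => A; split => [|FA].
  by rewrite /within/= => FA; apply: filterS2 FA FD => z /= DA Dz; exact: DA.
by apply: filterS FA.
Qed.

Section velocity.
Context {R : realType}.

Lemma cvg_shift_dnbhs (t : R) : h + t @[h --> 0^'] --> t^'.
Proof.
move=> A /nbhs_ballP[e /= e0 tA]; apply/nbhs_ballP; exists e => //= h.
rewrite /ball/= sub0r normrN => he h0; apply: tA; last first.
  by rewrite -subr_eq0 addrK.
by rewrite /ball/= opprD addrCA subrr addr0 normrN.
Qed.

Lemma is_derive_within (D : set R) (g : R -> R) (t : R) :
  nbhs t D -> derivable_within D g t -> is_derive t 1 g (derive_within D g t).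
Proof.
move=> tD; rewrite /derivable_within /derive_within within_filterE; last first.
  exact: nbhs_dnbhs tD.
move=> gt; set l := lim _.
suff gl : h^-1 *: ((g \o shift t) (h *: 1) - g t) @[h --> 0^'] --> l.
  by apply: DeriveDef; [apply/cvg_ex; exists l|exact: cvg_lim].
apply: cvg_trans (cvg_comp _ _ (@cvg_shift_dnbhs t) gt).
apply: near_eq_cvg; near=> h => /=.
by rewrite addrK [h%:A]mulr1 mulrC.
Unshelve. all: by end_near. Qed.

(** For [t] in the open interval, [[0, 1]] is a neighbourhood of [t], so the relative derivatives in
    [velocity] are two-sided. The chain rule then applies, and expanding the velocity in the
    standard basis produces the gradient. *)
Lemma is_derive_comp_velocity {n : nat} (f : 'rV[R]_n -> R)
    (g : R -> 'rV[R]_n) (t : R) :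
  differentiable f (g t) -> 0 < t < 1 ->
  (forall i, derivable_within `[0, 1] (fun s => g s 0 i) t) ->
  is_derive t 1 (f \o g) (dot (gradient f (g t)) (velocity g t)).
Proof.
move=> dfg t01 dg.
have D01 : nbhs t (`[0, 1]%classic : set R).
  have : t \in `]0, 1[ by rewrite in_itv.
  by move=> /near_in_itvoo; apply: filterS => s; apply: subset_itv_oo_cc.
have dgi i : is_derive t 1 (fun s => g s 0 i) (velocity g t 0 i).
  by rewrite mxE; exact: is_derive_within.
have dgt : derivable g t 1.
  by apply/derivable_mxP => j i; rewrite ord1; exact: ex_derive.
have difg : differentiable g t by apply/derivable1_diffP.
have velE : 'd g t 1 = velocity g t.
  rewrite -(@deriveE _ _ _ g t 1 difg) derive_mx//.
  apply/matrixP => j i; rewrite ord1 mxE.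
  exact: derive_val.
apply: DeriveDef.
  by apply/derivable1_diffP; exact: differentiable_comp.
rewrite (@deriveE _ _ _ _ t 1); last exact: differentiable_comp.
rewrite diff_comp//= velE [in LHS](row_sum_delta (velocity g t)) linear_sum.
apply: eq_bigr => i _.
by rewrite linearZ/= [gradient f _ 0 i]mxE deriveE// mulrC.
Qed.

End velocity.

(** * The backtracking search *)

Lemma armijo_search_le {R : realType} {n : nat} {f : 'rV[R]_n -> R}
    {g : R -> 'rV[R]_n} {x d : 'rV[R]_n} {Delta0 sigma delta t : R} :
  0 < Delta0 -> 0 < delta < 1 ->
  armijo_search_output f g x d Delta0 sigma delta t ->
  0 < t <= Delta0.
Proof.
move=> D0 /andP[d0 d1] [j [-> _ _]].
by rewrite mulr_gt0 ?exprn_gt0//= ger_pMr// exprn_ile1// ltW.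
Qed.

(** The strict bound excludes exponent 0, so [t / delta] is itself a trial step, rejected before [t]
    was reached. *)
Lemma armijo_search_previous {R : realType} {n : nat} {f : 'rV[R]_n -> R}
    {g : R -> 'rV[R]_n} {x d : 'rV[R]_n} {Delta0 sigma delta t : R} :
  0 < Delta0 -> 0 < delta < 1 ->
  armijo_search_output f g x d Delta0 sigma delta t -> t < Delta0 ->
  t / delta <= Delta0 /\ ~ armijo_condition f g x d sigma (t / delta).
Proof.
move=> D0 /andP[d0 d1] [[|j] [-> _ failed]]; first by rewrite expr0 mulr1 ltxx.
move=> _; rewrite exprSr mulrA mulfK ?gt_eqF//; split; last exact: failed.
by rewrite ger_pMr// exprn_ile1// ltW.
Qed.

(** * Mean value theorem and limiting slopes along search curves *)

Section curves.
Context {R : realType} {n p : nat}.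
Context {f : 'rV[R]_n -> R}
  {gamma : R -> 'rV[R]_n -> 'rV[R]_n -> 'rV[R]_p -> 'rV[R]_n}
  (gammaP : admissible_family gamma).

Lemma curve_MVT (x d : 'rV[R]_n) (xi : 'rV[R]_p) (s : R) :
  (forall y, differentiable f y) -> 0 < s <= 1 ->
  exists2 th, 0 < th < s &
    f (gamma s x d xi) - f x =
    dot (gradient f (gamma th x d xi))
        (velocity (fun r => gamma r x d xi) th) * s.
Proof.
move=> fd /andP[s0 s1]; pose g r := gamma r x d xi.
have [r r0s||th] := @MVT R (f \o g)
    (fun r => dot (gradient f (g r)) (velocity g r)) 0 s s0.
- move: r0s; rewrite in_itv/= => /andP[r0 rs].
  have r1 := lt_le_trans rs s1.
  apply: is_derive_comp_velocity; [exact: fd|by rewrite r0|move=> i].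
  by apply: (admissible_derivable gammaP); rewrite !ltW.
(* Continuity up to the endpoints comes from the joint continuity of [gamma], with all arguments but
   the time frozen. *)
- apply/subspace_continuousP => r; rewrite /= in_itv/= => /andP[r0 rs].
  apply: (cvg_comp g f); last exact: differentiable_continuous (fd (g r)).
  have Dr : curve_domain (r, x, d, xi).
    by rewrite /curve_domain/= r0 (le_trans rs).
  have uD : \forall r' \near within `[0, s] (nbhs r),
      curve_domain (r', x, d, xi).
    near=> r'.
    have : r' \in `[0, s] by near: r'; exact: withinT.
    by rewrite in_itv /curve_domain/= => /andP[-> /le_trans]; exact.
  have ur : (r', x, d, xi) @[r' --> within `[0, s] (nbhs r)] --> (r, x, d, xi).
    apply: (cvg_pair (cvg_pair (cvg_pair (cvg_within _) (cvg_cst x))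
      (cvg_cst d)) (cvg_cst xi)).
  exact: cvg_within_comp _ (admissible_continuous gammaP) Dr uD ur.
rewrite in_itv/= => ths; rewrite subr0 /= {2}/g (admissible_start gammaP) => ->.
by exists th.
Unshelve. all: by end_near. Qed.

(** Joint continuity on [curve_domain] allows time, point, direction and parameter to vary together;
    at time 0 the family starts at [xbar] with velocity [dbar], whatever [xibar] is. *)
Lemma cvg_curve_slope {I : Type} {F : set_system I} {th : I -> R}
    {x d : I -> 'rV[R]_n} {xi : I -> 'rV[R]_p}
    {xbar dbar : 'rV[R]_n} {xibar : 'rV[R]_p} :
  Filter F -> continuous (gradient f) ->
  (\forall i \near F, 0 <= th i <= 1) -> th @ F --> 0 ->
  x @ F --> xbar -> d @ F --> dbar -> xi @ F --> xibar ->
  dot (gradient f (gamma (th i) (x i) (d i) (xi i)))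
      (velocity (fun r => gamma r (x i) (d i) (xi i)) (th i)) @[i --> F]
    --> dot (gradient f xbar) dbar.
Proof.
move=> FF gradf th01 th0 xbarP dbarP xibarP.
pose u i := (th i, x i, d i, xi i).
have uP : u @ F --> (0, xbar, dbar, xibar).
  exact: (cvg_pair (cvg_pair (cvg_pair th0 xbarP) dbarP) xibarP).
have D0 : curve_domain (0 : R, xbar, dbar, xibar).
  by rewrite /curve_domain/= lexx ler01.
have uD : \forall i \near F, curve_domain (u i) by exact: th01.
apply: cvg_dot.
  have := cvg_within_comp FF (admissible_continuous gammaP) D0 uD uP.
  rewrite /= (admissible_start gammaP) => gammaxbar.
  exact: (continuous_cvg _ (gradf xbar) gammaxbar).
have := cvg_within_comp FF (admissible_velocity_continuous gammaP) D0 uD uP.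
by rewrite /= (admissible_velocity_start gammaP).
Qed.

End curves.

(** * Convergence of the curve search method *)

Theorem proposition2 (R : realType) (n p : nat)
    (f : 'rV[R]_n -> R)
    (gamma : R -> 'rV[R]_n -> 'rV[R]_n -> 'rV[R]_p -> 'rV[R]_n)
    (x d : nat -> 'rV[R]_n) (xi : nat -> 'rV[R]_p) (t : nat -> R)
    (Delta0 sigma delta : R)
    (f_C1 : continuously_differentiable f)
    (level_compact : compact [set y : 'rV[R]_n | f y <= f (x 0%N)])
    (gamma_admissible : admissible_family gamma)
    (x_succ : forall k : nat, x k.+1 = gamma (t k) (x k) (d k) (xi k))
    (Delta0_range : 0 < Delta0 <= 1)
    (sigma_range : 0 < sigma < 1)
    (delta_range : 0 < delta < 1)
    (t_armijo : forall k : nat,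
      armijo_search_output f (fun s => gamma s (x k) (d k) (xi k))
        (x k) (d k) Delta0 sigma delta (t k))
    (g_related : gradient_related f x
      (fun k s => gamma s (x k) (d k) (xi k)))
    (xi_bounded : exists2 C : R, 0 < C & forall k : nat, norm2 (xi k) <= C) :
  (exists xbar : 'rV[R]_n, accumulation_point x xbar) /\
  (forall xbar : 'rV[R]_n, accumulation_point x xbar -> gradient f xbar = 0).
Proof.
have [fd gradf] := f_C1; have [c1 [c2 [c1_gt0 c2_gt0 g_rel]]] := g_related.
have [C C_gt0 xiC] := xi_bounded.
have [D0 D1] := andP Delta0_range; have [s0 s1] := andP sigma_range.
have [de0 de1] := andP delta_range.
pose N k := norm2 (gradient f (x k)).
have tP k := armijo_search_le D0 delta_range (t_armijo k).
have slope k : dot (gradient f (x k)) (d k) <= - c1 * N k ^+ 2.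
  by have [] := g_rel k; rewrite (admissible_velocity_start gamma_admissible).
have d_le k : norm2 (d k) <= c2 * N k.
  by have [] := g_rel k; rewrite (admissible_velocity_start gamma_admissible).
(* Inserting the bound [slope] into the accepted Armijo inequality bounds the decrease of [f] below
   by [sigma * c1 * t k * N k ^+ 2]. *)
have descent k : t k * N k ^+ 2 <= (f (x k) - f (x k.+1)) / (sigma * c1).
  rewrite ler_pdivlMr ?mulr_gt0// lerBrDl -lerBrDr x_succ.
  have [j [tk]] := t_armijo k; rewrite -tk => /le_trans + _; apply.
  have /andP[tk0 _] := tP k.
  have st0 : 0 <= sigma * t k by rewrite ltW// mulr_gt0.
  by have := ler_wpM2l st0 (slope k); rewrite lerD2l; lra.
have fx_dec : nonincreasing_seq (f \o x).
  apply/nonincreasing_seqP => k /=; rewrite -subr_ge0.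
  have /andP[tk0 _] := tP k.
  have : 0 <= (f (x k) - f (x k.+1)) / (sigma * c1).
    by apply: le_trans (descent k); rewrite mulr_ge0 ?sqr_ge0// ltW.
  by rewrite pmulr_lge0// invr_gt0 mulr_gt0.
split.
  have [|y [_ xy]] := level_compact (x @ \oo) _.
    by exists 0%N => // k _; exact: fx_dec (leq0n k).
  by exists y.
move=> y xy; apply: norm2_eq0; apply/eqP; apply: contraT => Ny0.
have {}Ny0 : 0 < norm2 (gradient f y) by rewrite lt_neqAle eq_sym Ny0 norm2_ge0.
have [G [GU ooG xG]] := cluster_ultra_cvg _ _ _ _ xy.
have fxG : f (x k) @[k --> G] --> f y.
  by apply: (continuous_cvg _ _ xG); exact: differentiable_continuous.
(* Every tail of the indices lies in [G], so by monotonicity the limit [f y] along [G] is a lower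
   bound of the values. *)
have fx_cvg : cvgn (f \o x).
  apply: nonincreasing_is_cvgn => //; exists (f y) => _ [k _ <-].
  apply: cvgr_to_le fxG _; apply: ooG; exists k => // m; exact: fx_dec.
(* This is proved along [\oo], since [G] need not be invariant under the index shift, and
   transferred to [G] below. *)
have fx_diff0 : (f (x k) - f (x k.+1)) / (sigma * c1) @[k --> \oo] --> 0.
  rewrite -(mul0r (sigma * c1)^-1) -(subrr (limn (f \o x))).
  apply: cvgM; last exact: cvg_cst.
  apply: cvgB => //.
  by have := fx_cvg; rewrite -(cvg_shiftS (f \o x)).
have gradG : gradient f (x k) @[k --> G] --> gradient f y.
  by apply: (continuous_cvg _ _ xG); exact: gradf.
have NG : N @ G --> norm2 (gradient f y) by exact: cvg_norm2.
have N2G : N k ^+ 2 @[k --> G] --> norm2 (gradient f y) ^+ 2.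
  exact: (cvgM NG NG).
have tG : t @ G --> 0.
  have tN0 : t k * N k ^+ 2 @[k --> G] --> 0.
    have fx_diff0G := cvg_trans (cvg_fmap2 ooG) fx_diff0.
    apply: (squeeze_cvgr (f := cst 0) _ (cvg_cst 0) fx_diff0G).
    near=> k; have /andP[tk0 _] := tP k.
    by rewrite /= descent andbT mulr_ge0 ?sqr_ge0 ?ltW.
  (* The limit of [N k ^+ 2] is positive, so this factor can be divided out of [tN0]. *)
  have N2V : (N k ^+ 2)^-1 @[k --> G] --> (norm2 (gradient f y) ^+ 2)^-1.
    by apply: cvgV => //; rewrite gt_eqF ?exprn_gt0.
  rewrite -(mul0r (norm2 (gradient f y) ^+ 2)^-1).
  apply: cvg_trans (cvgM tN0 N2V).
  apply: near_eq_cvg; near=> k; rewrite /= mulfK// gt_eqF// exprn_gt0//.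
  by near: k; exact: (cvgr_gt _ NG).
have [dbar dG] : exists dbar : 'rV[R]_n, d @ G --> dbar.
  (* The added 1 is slack: along [G], [N k] is eventually below its limit plus 1. *)
  apply: (ultra_norm2_bounded_cvg G d (c2 * (norm2 (gradient f y) + 1)) GU).
  near=> k; apply: le_trans (d_le k) _; rewrite ler_pM2l// ltW//.
  by near: k; apply: (cvgr_lt _ NG); rewrite ltrDl.
have [xibar xiG] : exists xibar : 'rV[R]_p, xi @ G --> xibar.
  by apply: (ultra_norm2_bounded_cvg G xi C GU); exact: nearW.
(* The value 0 taken when [t k = Delta0] is a dummy: [tlt] shows that this case eventually does not
   occur along [G]. *)
have /choice[th thP] k : exists th, t k < Delta0 ->
    0 < th < t k / delta /\
    sigma * dot (gradient f (x k)) (d k) <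
    dot (gradient f (gamma th (x k) (d k) (xi k)))
        (velocity (fun r => gamma r (x k) (d k) (xi k)) th).
  have [tkD|_] := ltP (t k) Delta0; last by exists 0.
  have [sD /negP failed] :=
    armijo_search_previous D0 delta_range (t_armijo k) tkD.
  have /andP[tk0 _] := tP k.
  have sk0 : 0 < t k / delta by rewrite divr_gt0.
  have [|th ths thE] :=
    curve_MVT gamma_admissible (x k) (d k) (xi k) (t k / delta) fd.
    by rewrite sk0 (le_trans sD).
  exists th => _; split=> //.
  (* Multiplied by the positive step [t k / delta], the slope inequality is exactly the failure of
     the Armijo condition there. *)
  rewrite -(ltr_pM2r sk0) -thE ltrBrDl; move: failed; rewrite -ltNge.
  by rewrite mulrAC.
have tlt : \forall k \near G, t k < Delta0 by exact: (cvgr_lt _ tG).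
have tdG : t k / delta @[k --> G] --> 0.
  by rewrite -(mul0r delta^-1); exact: cvgM tG (cvg_cst _).
have thG : th @ G --> 0.
  apply: (squeeze_cvgr (f := cst 0) _ (cvg_cst 0) tdG).
  apply: filterS tlt => k /thP[/andP[/ltW th0 /ltW ths] _].
  by rewrite /= th0 ths.
have th01 : \forall k \near G, 0 <= th k <= 1.
  apply: filterS2 tlt (cvgr_lt _ thG _ ltr01) => k.
  by move=> /thP[/andP[/ltW-> _] _] /ltW.
have xdG : dot (gradient f (x k)) (d k) @[k --> G] --> dot (gradient f y) dbar.
  exact: cvg_dot.
have sxdG : sigma * dot (gradient f (x k)) (d k) @[k --> G] -->
    sigma * dot (gradient f y) dbar by exact: cvgM (cvg_cst _) xdG.
have c1NG : - c1 * N k ^+ 2 @[k --> G] --> - c1 * norm2 (gradient f y) ^+ 2.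
  exact: cvgM (cvg_cst _) N2G.
have lim_ge : sigma * dot (gradient f y) dbar <= dot (gradient f y) dbar.
  apply: ler_cvg_to sxdG
    (cvg_curve_slope gamma_admissible _ gradf th01 thG xG dG xiG) _.
  by apply: filterS tlt => k /thP[_ /ltW].
have dot_lt0 : dot (gradient f y) dbar < 0.
  apply: le_lt_trans (ler_cvg_to xdG c1NG (nearW _ slope)) _.
  by rewrite mulNr oppr_lt0 mulr_gt0 ?exprn_gt0.
(* Dividing [lim_ge] by the negative inner product would give [1 <= sigma]. *)
by move: lim_ge; rewrite ger_nMl// leNgt s1.
Unshelve. all: by end_near. Qed.
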